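(* Let $N \geq 5$ be an integer and let $\lambda$ be a real number with $\frac{3}{2} \leq \lambda \leq 2$. Let $X$ be an ultra log-affine random variable with parameter $\lambda$ supported on $\{0,1,2,\dots,N\}$, i.e. an integer-valued random variable with $$\mathbb{P}\{X=n\} = C\,\frac{\lambda^n}{n!} \quad \text{for } n \in \{0,1,\dots,N\}, \qquad C = \Big(\sum_{k=0}^{N} \frac{\lambda^k}{k!}\Big)^{-1},$$ and $\mathbb{P}\{X=n\}=0$ for all other integers $n$. Let $Z$ be a Poisson random variable with parameter $\mathbb{E}[X]$. Then $$\max_n \mathbb{P}\{X=n\} < \max_n \mathbb{P}\{Z=n\}.$$
   Context: An ultra log-affine random variable with parameter $\lambda$ and compact support is an integer-valued random variable whose probability mass function is $p(n) = C\,\frac{\lambda^n}{n!}$ for $n \in \{K,K+1,\dots,N\}$ (and zero elsewhere), where $0 \leq K \leq N$ are integers and $C$ is the normalizing constant; here $K=0$. A Poisson random variable $Z$ with parameter $\mu>0$ satisfies $\mathbb{P}\{Z=n\} = e^{-\mu}\mu^n/n!$ for $n=0,1,2,\dots$. The maxima are taken over all integers $n$ (equivalently over all integers $n \geq 0$). *)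

(* Defs.v *)
From HB Require Import structures.
From mathcomp Require Import all_boot all_order all_algebra.
From mathcomp Require Import all_classical all_reals all_analysis.

Set Implicit Arguments.
Unset Strict Implicit.
Unset Printing Implicit Defensive.

Import Order.TTheory GRing.Theory Num.Theory.

Local Open Scope classical_set_scope.
Local Open Scope ring_scope.

(* Integer-valued random variables are modelled as real-valued ones all of
   whose values are integers, so that the expectation and [pmf] of
   MathComp-Analysis apply to them directly. *)
Definition integer_valued d (T : measurableType d) (R : realType)
    (P : probability T R) (X : {RV P >-> R}) : Prop :=
  forall t, X t \is a Num.int.

Definition prob_at d (T : measurableType d) (R : realType)
    (P : probability T R) (X : {RV P >-> R}) (n : int) : R :=
  @pmf d T R P X n%:~R.

Definition ula_const (R : realType) (lambda : R) (K N : nat) : R :=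
  (\sum_(K <= k < N.+1) lambda ^+ k / k`!%:R)^-1.

Definition ultra_log_affine d (T : measurableType d) (R : realType)
    (P : probability T R) (X : {RV P >-> R})
    (lambda : R) (K N : nat) : Prop :=
  integer_valued X /\
  forall n : int, prob_at X n =
    if n is Posz k then
      if (K <= k <= N)%N then ula_const lambda K N * (lambda ^+ k / k`!%:R)
      else 0
    else 0.

(* [poisson_pmf mu k] is mu ^+ k / k`! * expR (- mu) only for 0 < mu (it has a
   default value otherwise), whence the explicit positivity condition. *)
Definition poisson_rv d (T : measurableType d) (R : realType)
    (P : probability T R) (Z : {RV P >-> R}) (mu : R) : Prop :=
  [/\ 0 < mu, integer_valued Z &
    forall n : int, prob_at Z n = if n is Posz k then poisson_pmf mu k else 0].

Definition is_max (R : realType) (A : set R) (m : R) : Prop :=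
  A m /\ ubound A m.

(* Main.v *)
Require Import Defs.
From HB Require Import structures.
From mathcomp Require Import all_boot all_order all_algebra.
From mathcomp Require Import all_classical all_reals all_analysis.
From mathcomp Require Import ring lra.
From mathcomp Require Import measurable_realfun.

(** Let [S_n] be the sum of the first [n] terms of the exponential series at
    [lambda], [a = lambda^N / N!] and [mu = E[X] = lambda S_N / S_(N+1)
    = lambda - lambda a / S_(N+1)]. Both maxima are attained at [1], so the
    claim is [lambda / S_(N+1) < mu exp (- mu)], that is
    [exp lambda < S_N exp (lambda a / S_(N+1))]. The right-hand side is at least
    [S_N (1 + lambda a / S_(N+1)) = S_N + a mu], and comparing the tail with a
    geometric series bounds the left-hand side by
    [S_N + a / (1 - lambda / (N+1))]; it remains to see that
    [mu (1 - lambda / (N+1)) > 1]. *)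

Import Order.TTheory GRing.Theory Num.Theory.

Local Open Scope classical_set_scope.
Local Open Scope ring_scope.

Lemma exp_coeffS (R : realType) (x : R) (n : nat) :
  exp_coeff x n.+1 = exp_coeff x n * (x / n.+1%:R).
Proof.
rewrite /exp_coeff /= factS natrM exprS; field.
by rewrite pnatr_eq0 -lt0n fact_gt0 addrC natr1 pnatr_eq0.
Qed.

Lemma exp_coeff_mulnS (R : realType) (x : R) (n : nat) :
  n.+1%:R * exp_coeff x n.+1 = x * exp_coeff x n.
Proof.
rewrite exp_coeffS mulrCA [n.+1%:R * _]mulrC divfK ?pnatr_eq0//.
by rewrite mulrC.
Qed.

Lemma exp_coeff_nonincreasing (R : realType) (x : R) (m n : nat) :
  0 <= x -> x <= m.+1%:R -> (m <= n)%N -> exp_coeff x n <= exp_coeff x m.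
Proof.
move=> x0 xm; elim: n => [|n IH]; first by rewrite leqn0 => /eqP ->.
rewrite leq_eqVlt => /predU1P[->//|]; rewrite ltnS => mn.
apply: le_trans (IH mn); rewrite exp_coeffS ler_piMr ?exp_coeff_ge0//.
by rewrite ler_pdivrMr ?ltr0n// mul1r (le_trans xm)// ler_nat.
Qed.

(* From index n on, consecutive terms of the exponential series have ratio at
   most x / (n + 1), so the tail is dominated by a geometric series. *)
Lemma expR_le_series_geometric (R : realType) (x : R) (n : nat) :
  0 <= x -> x < n.+1%:R ->
  expR x <= series (exp_coeff x) n + exp_coeff x n / (1 - x / n.+1%:R).
Proof.
move=> x0 xn; set q := x / _.
have q1 : 0 < 1 - q by rewrite subr_gt0 ltr_pdivrMr ?ltr0n// mul1r.
(* Since [q] stays frozen at index [n], the bound [u] is nonincreasing from [n] on: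
   [1 / (1 - q) = 1 + q / (1 - q)], and later ratios are at most [q]. As [u k] dominates the [k]-th
   partial sum, so does [u n], and hence it dominates the limit. *)
pose u k := series (exp_coeff x) k + exp_coeff x k / (1 - q).
have u_le k : (n <= k)%N -> u k <= u n.
  elim: k => [|k IH]; first by rewrite leqn0 => /eqP ->.
  rewrite leq_eqVlt => /predU1P[->//|]; rewrite ltnS => nk.
  apply: le_trans (IH nk); rewrite /u seriesSr -addrA lerD2l.
  have -> : exp_coeff x k / (1 - q)
            = exp_coeff x k + exp_coeff x k * q / (1 - q).
    by field; rewrite gt_eqF.
  rewrite lerD2l ler_pM2r ?invr_gt0// exp_coeffS.
  apply: ler_wpM2l; first exact: exp_coeff_ge0.
  by rewrite ler_wpM2l// lef_pV2 ?posrE ?ltr0n// ler_nat.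
apply: limr_le; first exact: is_cvg_series_exp_coeff.
near=> k; apply: le_trans (u_le k _); last by near: k; exact: nbhs_infty_ge.
by rewrite lerDl divr_ge0 ?exp_coeff_ge0// ltW.
Unshelve. all: by end_near. Qed.

(** The bounds [1 < mu <= 2] make 1 a mode of the Poisson law; the last inequality compares the two
    masses at 1. *)
Lemma truncated_exp_poisson_mode (R : realType) (N : nat) (x : R)
    (S := series (exp_coeff x)) (mu := x * S N / S N.+1) :
  (5 <= N)%N -> 3 / 2 <= x <= 2 ->
  [/\ 1 < mu, mu <= 2 & x / S N.+1 < mu * expR (- mu)].
Proof.
move=> N5 /andP[x1 x2]; have x0 : 0 <= x by lra.
pose a := exp_coeff x N.
have SE : S N.+1 = S N + a by rewrite /S seriesSr.
have a0 : 0 < a.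
  by rewrite /a /exp_coeff /= divr_gt0 ?exprn_gt0 ?ltr0n ?fact_gt0//; lra.
(* [4 / 15] is [2 ^ 5 / 5!]. *)
have x5 : exp_coeff x 5 <= 4 / 15.
  rewrite /exp_coeff /= (_ : 5`! = 120%N)//.
  have : x ^+ 5 <= 2 ^+ 5 by rewrite lerXn2r ?nnegrE.
  by rewrite ler_pdivrMr ?ltr0n//; lra.
have a_le : a <= 4 / 15.
  by apply: le_trans x5; apply: exp_coeff_nonincreasing => //; lra.
have S_ge : 1 + x + x ^+ 2 / 2 <= S N.
  have -> : 1 + x + x ^+ 2 / 2 = S 3.
    rewrite /S /series /= !big_nat_recr//= big_geq// /exp_coeff /=.
    by rewrite expr0 expr1 !divr1 add0r.
  apply: nondecreasing_series => [k _ _|]; first exact: exp_coeff_ge0.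
  exact: leq_trans N5.
(* [29 / 8] is the value of [1 + x + x ^ 2 / 2] at [x = 3 / 2]. *)
have SN_ge : 29 / 8 <= S N by nra.
have S0 : 0 < S N.+1 by lra.
(* The ratio [S N / (S N + a)] exceeds [8 / 9] because [S N > 8 a]. *)
have mu_gt : x * (8 / 9) < mu by rewrite /mu ltr_pdivlMr// -mulrA ltr_pM2l; lra.
pose q := x / N.+1%:R.
have q_le : q <= x / 6 by rewrite ler_wpM2l// lef_pV2 ?posrE ?ltr0n// ler_nat.
(* x (8/9) (1 - x/6) >= 1 on [3/2, 2], with equality at x = 3/2 *)
have mu_q : 1 < mu * (1 - q).
  apply: (@le_lt_trans _ _ (x * (8 / 9) * (1 - q))); last first.
    by rewrite ltr_pM2r//; lra.
  apply: (@le_trans _ _ (x * (8 / 9) * (1 - x / 6))); first by nra.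
  by rewrite ler_wpM2l//; lra.
split; first by lra.
  by rewrite /mu ler_pdivrMr// ler_pM// ?SE; lra.
have exp_lt : expR x < S N * expR (x * a / S N.+1).
  apply: le_lt_trans (expR_le_series_geometric _ x N x0 _) _.
    by rewrite (le_lt_trans x2)// ltr_nat ltnS (leq_trans _ N5).
  apply: (@lt_le_trans _ _ (S N * (1 + x * a / S N.+1))); last first.
    by rewrite ler_wpM2l ?expR_ge1Dx//; lra.
  have -> : S N * (1 + x * a / S N.+1) = S N + a * mu.
    by rewrite /mu; field; rewrite gt_eqF.
  by rewrite ltrD2l ltr_pM2l// -/q -div1r ltr_pdivrMr//; lra.
(* Multiplying the goal by [expR x] and cancelling [x / S N.+1] leaves exactly [exp_lt]. *)
have -> : - mu = x * a / S N.+1 - x.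
  by rewrite /mu SE; field; rewrite -SE gt_eqF.
rewrite expRD expRN mulrA ltr_pdivlMr ?expR_gt0//.
have -> : mu = x / S N.+1 * S N by rewrite /mu mulrAC.
by rewrite -mulrA ltr_pM2l// divr_gt0//; lra.
Qed.

(** Since the listed masses add up to 1, [X] is almost surely a finite combination of indicators,
    which is integrated term by term. *)
Lemma expectation_nat_support d (T : measurableType d) (R : realType)
    (P : probability T R) (X : {RV P >-> R}) (n : nat) :
  \sum_(0 <= k < n) pmf X k%:R = 1 ->
  'E_P[X]%E = (\sum_(0 <= k < n) k%:R * pmf X k%:R)%:E.
Proof.
move=> sum1; pose A k := X @^-1` [set k%:R].
have mA k : measurable (A k) by rewrite /A -[X @^-1` _]setTI; exact: measurable_funP.
have PA k : P (A k) = (pmf X k%:R)%:E by rewrite /pmf fineK ?fin_num_measure.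
have tA : trivIset setT A.
  apply/trivIsetP => i j _ _ ij; rewrite -subset0 => t [Ai Aj].
  by have /eqP := etrans (esym Ai) Aj; rewrite eqr_nat (negbTE ij).
pose U := \big[setU/set0]_(k < n) A k.
have mU : measurable U by exact: bigsetU_measurable.
have PU : P (~` U) = 0%E.
  rewrite probability_setC// measure_bigsetU//.
  rewrite (eq_bigr (fun k : 'I_n => (pmf X k%:R)%:E)) => [|k _]; last exact: PA.
  by rewrite sumEFin -(big_mkord xpredT (fun k => pmf X k%:R)) sum1 subee.
rewrite unlock.
pose f k t : \bar R := (k%:R * \1_(A k) t)%:E.
pose g t := (\sum_(0 <= k < n) f k t)%E.
have mf k : measurable_fun setT (f k).
  by apply/measurable_EFinP; exact: measurable_funM.
rewrite (ae_eq_integral g)//=; first last.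
- exists (~` U); split => //; first exact: measurableC.
  apply: subsetC => t; rewrite /U -bigcup_mkord => -[k /= kn Akt] _.
  rewrite /g sumEFin (bigD1_seq k) ?mem_index_iota ?iota_uniq//=.
  rewrite big1 => [|j jk]; first by rewrite indicE mem_set// mulr1 addr0 -Akt.
  rewrite indicE memNset ?mulr0// => Ajt; move: jk; rewrite -(eqr_nat R).
  by rewrite -Ajt -Akt eqxx.
- exact: emeasurable_sum.
- exact/measurable_EFinP.
rewrite ge0_integral_sum//; last first.
  by move=> k t _; rewrite lee_fin mulr_ge0.
rewrite -sumEFin; apply: eq_bigr => k _.
rewrite (integralZl_indic _ (fun=> A k))//; last by rewrite ltrn0.
by rewrite integral_indic// setIT EFinM; congr (_ * _)%E; exact: PA.
Qed.

Theorem mainTheorem1 (R : realType)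
    (dX dZ : measure_display)
    (TX : measurableType dX) (TZ : measurableType dZ)
    (PX : probability TX R) (PZ : probability TZ R)
    (X : {RV PX >-> R}) (Z : {RV PZ >-> R})
    (N : nat) (lambda : R) :
  (5 <= N)%N ->
  3 / 2 <= lambda <= 2 ->
  ultra_log_affine X lambda 0 N ->
  poisson_rv Z (fine 'E_PX[X]%E) ->
  exists maxX maxZ : R,
    [/\ is_max (range (prob_at X)) maxX,
        is_max (range (prob_at Z)) maxZ &
        maxX < maxZ].
Proof.
move=> N5 l_itv [_ pX] [_ _ pZ].
have /andP[l1 l2] := l_itv.
have l0 : 0 <= lambda by lra.
set S := series (exp_coeff lambda).
(* [series] at [n] sums the indices below [n], so the normalizing sum over [0..N] is [S N.+1]. *)
have CE : ula_const lambda 0 N = (S N.+1)^-1 by [].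
have S0 : 0 < S N.+1.
  rewrite /S /series /= big_nat_recl// ltr_pwDl// ?sumr_ge0// => [|i _].
    by rewrite /exp_coeff /= expr0 divr1.
  exact: exp_coeff_ge0.
have pXk k : (k <= N)%N -> pmf X k%:R = exp_coeff lambda k / S N.+1.
  by move=> kN; have := pX k; rewrite /prob_at /= kN CE mulrC => <-.
have EX : fine 'E_PX[X]%E = lambda * S N / S N.+1.
  rewrite (@expectation_nat_support _ _ _ _ _ N.+1)/=; last first.
    rewrite (eq_big_nat _ _ (F2 := fun k => exp_coeff lambda k / S N.+1)).
      by rewrite -mulr_suml divff// gt_eqF.
    by move=> k /andP[_ kN]; rewrite pXk.
  (* The term at 0 vanishes; in the others the factor [k.+1] cancels against the factorial, leaving
     [lambda] times the term at [k]. *)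
  rewrite big_nat_recl// mul0r add0r /S /series /= mulr_sumr mulr_suml.
  apply: eq_big_nat => k /andP[_ kN].
  by rewrite pXk// mulrA exp_coeff_mulnS.
rewrite EX in pZ.
have [mu1 mu2 lt_max] := truncated_exp_poisson_mode _ _ _ N5 l_itv.
set mu := lambda * S N / S N.+1 in mu1 mu2 lt_max pZ.
have mu0 : 0 < mu by lra.
have pZE k : poisson_pmf mu k = exp_coeff mu k * expR (- mu).
  by rewrite /poisson_pmf mu0.
have coeff1 (y : R) : exp_coeff y 1 = y by rewrite /exp_coeff /= expr1 divr1.
(* This locates both modes at 1, with [y] equal to [lambda] or [mu]: [y >= 1] handles index 0, and
   [y <= 2] makes the terms nonincreasing from index 1 on. *)
have coeff_le1 (y : R) k : 1 <= y -> y <= 2 -> exp_coeff y k <= y.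
  move=> y1 y2; rewrite -[leRHS]coeff1; case: k => [|k].
    by rewrite coeff1 /exp_coeff /= expr0 divr1.
  by apply: exp_coeff_nonincreasing => //; lra.
exists (lambda / S N.+1), (mu * expR (- mu)); split => //; split.
- exists 1 => //; rewrite (pX 1%N) /= (leq_trans _ N5)// CE mulrC.
  by rewrite -[_ / 1`!%:R]/(exp_coeff lambda 1) coeff1.
- move=> _ [[k|k] _ <-]; rewrite pX ?divr_ge0 ?(ltW S0)//.
  case: ifP => _; last by rewrite divr_ge0// ltW.
  rewrite CE mulrC ler_pM2r ?invr_gt0//.
  by apply: (coeff_le1 lambda k) => //; lra.
- by exists 1 => //; rewrite (pZ 1%N) pZE coeff1.
- move=> _ [[k|k] _ <-]; rewrite pZ.
    by rewrite pZE ler_pM2r ?expR_gt0// coeff_le1// ltW.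
  by rewrite mulr_ge0 ?expR_ge0// ltW.
Qed.
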